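(* Let $G$ be a pseudo-$H$-type Lie group with Lie algebra $\mathfrak{g}=\mathfrak{v}\dot{+}\mathfrak{z}$ and scalar product $\langle\cdot,\cdot\rangle$ as in the context. The stability of the equilibrium points $0+Y_{\mathfrak{z}}\in\mathfrak{v}\dot{+}\mathfrak{z}$ of the Lie-Poisson equation $\frac{dY_{\mathfrak{v}}}{dt}=j(Y_{\mathfrak{z}})Y_{\mathfrak{v}}$, $\frac{dY_{\mathfrak{z}}}{dt}=0$ is described as follows. 1. If $\langle Y_{\mathfrak{z}},Y_{\mathfrak{z}}\rangle_{\mathfrak{z}}<0$, then $j(Y_{\mathfrak{z}})$ has only real eigenvalues, and thus the equilibrium point $0+Y_{\mathfrak{z}}$ is unstable. 2. If $\langle Y_{\mathfrak{z}},Y_{\mathfrak{z}}\rangle_{\mathfrak{z}}>0$, then $j(Y_{\mathfrak{z}})$ has only purely imaginary eigenvalues, and thus the equilibrium point $0+Y_{\mathfrak{z}}$ is Lyapunov stable.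
   Context: Setting. $G$ is a Lie group whose real finite-dimensional Lie algebra $\mathfrak{g}$ is step-two nilpotent: $[\mathfrak{g},\mathfrak{g}]\subset\mathfrak{z}$, where $\mathfrak{z}$ is the centre. $\langle\cdot,\cdot\rangle$ is a scalar product (non-degenerate symmetric bilinear form, possibly indefinite) on $\mathfrak{g}$ whose restriction $\langle\cdot,\cdot\rangle_{\mathfrak{z}}$ to $\mathfrak{z}$ is non-degenerate. $\mathfrak{v}=\mathfrak{z}^{\perp}$, so $\mathfrak{g}=\mathfrak{v}\dot{+}\mathfrak{z}$ (orthogonal direct sum), and the restriction $\langle\cdot,\cdot\rangle_{\mathfrak{v}}$ is non-degenerate. Write $Y=Y_{\mathfrak{v}}+Y_{\mathfrak{z}}$. The $j$-mapping $j:\mathfrak{z}\to\mathrm{End}(\mathfrak{v})$ is defined by $\langle j(Z)V,V'\rangle_{\mathfrak{v}}=\langle Z,[V,V']\rangle_{\mathfrak{z}}$. $G$ is a pseudo-$H$-type Lie group if in addition $\langle j(Z)V,j(Z)V'\rangle_{\mathfrak{v}}=\langle Z,Z\rangle_{\mathfrak{z}}\langle V,V'\rangle_{\mathfrak{v}}$ for all $V,V'\in\mathfrak{v}$, $Z\in\mathfrak{z}$. Identify $\mathfrak{g}\cong\mathfrak{g}^*$ via $Y\mapsto\langle Y,\cdot\rangle$; the coadjoint orbit through $Y$ is $\{(\mathrm{Ad}_q)^{\mathrm{T}}Y:q\in G\}$, where $A^{\mathrm{T}}$ is the adjoint of $A$ for $\langle\cdot,\cdot\rangle$. The Lie-Poisson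 equation of the claim is the reduction to $\mathfrak{g}\cong\mathfrak{g}^*$ of the geodesic flow of the left-invariant metric defined by $\langle\cdot,\cdot\rangle$; it restricts to each coadjoint orbit, and its equilibria are the points with $Y_{\mathfrak{v}}\in\ker j(Y_{\mathfrak{z}})$. Stability and instability are meant for the restriction of the equation to the (generic, i.e. here $\langle Y_{\mathfrak{z}},Y_{\mathfrak{z}}\rangle_{\mathfrak{z}}\ne0$) coadjoint orbit through the equilibrium. *)

(* Defs.v *)
From HB Require Import structures.
From mathcomp Require Import all_boot all_order all_algebra.
From mathcomp Require Import all_classical all_reals all_analysis.
From mathcomp Require Import complex.

Set Implicit Arguments.
Unset Strict Implicit.
Unset Printing Implicit Defensive.

Import Order.TTheory GRing.Theory Num.Theory.
Import numFieldNormedType.Exports.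

Local Open Scope classical_set_scope.
Local Open Scope ring_scope.

HB.mixin Record isTopologicalGroup G of Topological G & Group G := {
  mulg_continuous : continuous (fun p : G * G => (p.1 * p.2)%g);
  invg_continuous : continuous (fun p : G => (p^-1)%g)
}.

#[short(type="topologicalGroupType")]
HB.structure Definition TopologicalGroup :=
  {G of Topological G & Group G & isTopologicalGroup G}.

Section Smooth.
Context (R : realType) (V W : normedModType R).

(* In finite dimension, [Cn k U f] for an open [U] says that [f] is of class
   C^k on [U]: the maps [x |-> 'd f x v], [v] fixed, are the coordinates of the
   differential of [f]. Values of [f] outside [U] are irrelevant. *)
Fixpoint Cn (k : nat) (U : set V) (f : V -> W) : Prop :=
  match k with
  | 0 => forall x, U x -> {for x, continuous f}
  | k.+1 => (forall x, U x -> differentiable f x) /\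
            (forall v, Cn k U (fun x => 'd f x v))
  end.

Definition smooth_on (U : set V) (f : V -> W) : Prop := forall k, Cn k U f.

End Smooth.

(* Partial homeomorphisms from [G] to R^n; [chart_inv] is only meaningful on
   the image of [chart_dom]. *)
Record chart (R : realType) (n : nat) (G : topologicalType) := Chart {
  chart_map :> G -> 'rV[R]_n;
  chart_inv : 'rV[R]_n -> G;
  chart_dom : set G;
  chart_dom_open : open chart_dom;
  chart_img_open : open (chart_map @` chart_dom);
  chart_mapK : forall p, chart_dom p -> chart_inv (chart_map p) = p;
  chart_map_continuous : forall p, chart_dom p -> {for p, continuous chart_map};
  chart_inv_continuous : forall x, (chart_map @` chart_dom) x ->
    {for x, continuous chart_inv}
}.

Definition chart_img (R : realType) (n : nat) (G : topologicalType)
  (a : chart R n G) : set 'rV[R]_n := a @` chart_dom a.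

Record lieGroup (R : realType) (n : nat) (G : topologicalGroupType) := LieGroup {
  atlas : set (chart R n G);
  lie_hausdorff : hausdorff_space G;
  lie_second_countable : @second_countable G;
  atlas_cover : forall p : G, exists2 a, atlas a & chart_dom a p;
  atlas_smooth : forall a b, atlas a -> atlas b ->
    smooth_on (a @` (chart_dom a `&` chart_dom b)) (b \o chart_inv a);
  mulg_smooth : forall a b c, atlas a -> atlas b -> atlas c ->
    smooth_on
      [set xy : 'rV[R]_n * 'rV[R]_n | [/\ chart_img a xy.1, chart_img b xy.2 &
         chart_dom c (chart_inv a xy.1 * chart_inv b xy.2)%g]]
      (fun xy => c (chart_inv a xy.1 * chart_inv b xy.2)%g);
  invg_smooth : forall a b, atlas a -> atlas b ->
    smooth_on
      [set x | chart_img a x /\ chart_dom b (chart_inv a x)^-1%g]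
      (fun x => b (chart_inv a x)^-1%g)
}.

Record lieAlgebra (R : realType) (V : vectType R) := LieAlgebra {
  lie_bracket :> {bilinear V -> V -> V};
  lie_bracketxx : forall x, lie_bracket x x = 0;
  lie_jacobi : forall x y z,
    lie_bracket x (lie_bracket y z) + lie_bracket y (lie_bracket z x)
      + lie_bracket z (lie_bracket x y) = 0
}.

Section LieAlgebra.
Context (R : realType) (V : vectType R) (g : lieAlgebra V).

Definition lie_center : {vspace V} :=
  (\bigcap_(i < \dim {:V}) lker (linfun (applyr g (vbasis {:V})`_i)))%VS.

Lemma lie_centerP x : reflect (forall y, g x y = 0) (x \in lie_center).
Proof.
apply: (iffP idP) => [/subv_bigcapP xz y|x0]; last first.
  by apply/subv_bigcapP => i _; rewrite -memvE memv_ker lfunE /= x0.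
rewrite (coord_vbasis (memvf y)) linear_sumr big1 // => i _.
have := xz i isT; rewrite -memvE memv_ker lfunE /= => /eqP xi0.
by rewrite linearZr /= xi0 scaler0.
Qed.

(* Nilpotent of class exactly two: abelian Lie algebras are excluded. *)
Definition step_two_nilpotent : Prop :=
  (forall x y, g x y \in lie_center) /\ (exists x y, g x y != 0).

End LieAlgebra.

(* The tangent space of [G] at the identity is identified with R^n by a chart
   [c] around the identity. *)
Section LieGroupAlgebra.
Context (R : realType) (n : nat) (G : topologicalGroupType).
Variable c : chart R n G.

(* The differential at the identity of conjugation by [q], read in [c]. *)
Definition Ad (q : G) : 'End('rV[R]_n) :=
  linfun ('d (fun x => c (q * chart_inv c x * q^-1)%g) (c 1%g)).

(* The bracket of the Lie algebra of [G] is the differential of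
   [q |-> Ad q Y] at the identity: [X, Y] = (d/ds) Ad_(q(s)) Y for a curve
   [q] through the identity with velocity [X]. *)
Definition is_lie_algebra_of (g : lieAlgebra 'rV[R]_n) : Prop :=
  forall X Y, is_derive (c 1%g) X (fun x => Ad (chart_inv c x) Y) (g X Y).

Definition is_adjoint (form : {symmetric 'rV[R]_n}) (A B : 'End('rV[R]_n)) :=
  forall x y, form (B x) y = form x (A y).

Definition coadjoint_orbit (form : {symmetric 'rV[R]_n}) (Y : 'rV[R]_n) :
    set 'rV[R]_n :=
  [set Y' | exists q B, is_adjoint form (Ad q) B /\ Y' = B Y].

End LieGroupAlgebra.

Section PseudoHType.
Context (R : realType) (V : vectType R).
Variables (g : lieAlgebra V) (form : {symmetric V}).

Definition nondegenerate_on (U : {vspace V}) : Prop :=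
  (U :&: orthov form U = 0)%VS.

Local Notation "'z" := (lie_center g).
Local Notation "'v" := (orthov form (lie_center g)).

Definition is_jmap (j : subvs_of 'z -> 'End(subvs_of 'v)) : Prop :=
  forall (Z : subvs_of 'z) (U U' : subvs_of 'v),
    form (vsval (j Z U)) (vsval U') = form (vsval Z) (g (vsval U) (vsval U')).

Definition pseudo_H_type (j : subvs_of 'z -> 'End(subvs_of 'v)) : Prop :=
  forall (Z : subvs_of 'z) (U U' : subvs_of 'v),
    form (vsval (j Z U)) (vsval (j Z U')) =
    form (vsval Z) (vsval Z) * form (vsval U) (vsval U').

Definition vpart (Y : V) : subvs_of 'v := vsproj 'v (daddv_pi 'v 'z Y).
Definition zpart (Y : V) : subvs_of 'z := vsproj 'z (daddv_pi 'z 'v Y).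

End PseudoHType.

Section Dynamics.
Context (R : realType) (n : nat).
Local Notation V := 'rV[R]_n.

Definition lie_poisson_solution (g : lieAlgebra V) (form : {symmetric V})
    (j : subvs_of (lie_center g) -> 'End(subvs_of (orthov form (lie_center g))))
    (y : R -> V) : Prop :=
  forall t : R,
    is_derive t 1 (fun s => vsval (vpart g form (y s)))
      (vsval (j (zpart g form (y t)) (vpart g form (y t)))) /\
    is_derive t 1 (fun s => vsval (zpart g form (y s))) 0.

(* Stability for the restriction to [O] of an equation, given by its set [sol]
   of solution curves, that leaves [O] invariant. *)
Definition lyapunov_stable_on (sol : set (R -> V)) (O : set V) (e : V) : Prop :=
  forall eps : R, 0 < eps -> exists2 delta : R, 0 < delta &
    forall y, sol y -> O (y 0) -> `|y 0 - e| < delta ->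
      forall t, 0 <= t -> `|y t - e| < eps.

Definition unstable_on (sol : set (R -> V)) (O : set V) (e : V) : Prop :=
  ~ lyapunov_stable_on sol O e.

End Dynamics.

(* Eigenvalues of the complexification of a real endomorphism. *)
Definition complex_eigenvalue (R : realType) (U : vectType R) (f : 'End(U))
    (lambda : R[i]) : bool :=
  eigenvalue (map_mx (real_complex R) (passmx.mxof (vbasis {:U}) (vbasis {:U}) f))
    lambda.

(* Main.v *)
Require Import Defs.
From HB Require Import structures.
From mathcomp Require Import all_boot all_order all_algebra.
From mathcomp Require Import all_classical all_reals all_analysis.
From mathcomp Require Import complex.
From mathcomp Require Import ring lra.

Set Implicit Arguments.
Unset Strict Implicit.
Unset Printing Implicit Defensive.

Import Order.TTheory GRing.Theory Num.Theory.
Import numFieldNormedType.Exports.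

Local Open Scope classical_set_scope.
Local Open Scope ring_scope.

(** Write J for j(Z).  Skewness of J together with the pseudo-H-type identity
    gives J^2 = - <Z,Z> on the orthogonal complement v of the centre z
    ([jmap_sqr]), so the eigenvalues of J square to - <Z,Z>: they are real when
    <Z,Z> is negative and imaginary when it is positive.  Everything else rests
    on the same identity at the points Y near the equilibrium, where the
    z-part Y_z is a constant of motion and v evolves by the linear equation
    v' = j(Y_z) v with j(Y_z)^2 = - <Y_z,Y_z>.

    Stability ([center_lyapunov_stable]).  For c = <Y_z,Y_z> positive each
    coordinate of v is a harmonic oscillator: if a is a coordinate of v and b
    the same coordinate of j(Y_z) v, then c a^2 + b^2 is conserved.  As c stays
    away from 0 and j(Y_z) v is small for Y near Z, the v-part stays small,
    uniformly over a neighbourhood of Z in the whole Lie algebra.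

    Instability ([center_unstable]).  For c negative put l = sqrt (- c).  The
    solution through Y is Y_z + e^(l t) p + e^(- l t) q with
    p = (v + l^-1 j(Y_z) v) / 2, and it is unbounded unless p = 0, that is
    j(Y_z) v = - l v.  Since <j(Y_z) v, v> = 0, this exceptional case forces
    <v,v> = 0; so a point with <v,v> != 0 always gives an unbounded solution
    ([unbounded_solution]).  It remains to find such points on the coadjoint
    orbit of Z, arbitrarily close to Z.  The curve (Ad_q)^T Z, for q leaving the
    identity with velocity X, leaves Z with velocity J X
    ([orbit_curve_derive]), whose square is <J X,J X> = <Z,Z> <X_v,X_v>, and X
    can be chosen to make this nonzero because the form is nondegenerate on
    v and v is not zero. *)

(** * Orthogonal complements *)

Section OrthogonalDecomposition.
Context (R : realType) (V : vectType R) (form : {symmetric V}).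

Lemma formC u v : form u v = form v u.
Proof. by rewrite hermC expr0 mul1r. Qed.

Lemma nondegenerate_eq0 u :
  nondegenerate form -> (forall w, form u w = 0) -> u = 0.
Proof.
move=> /eqP nd u0; apply/eqP; rewrite -memv0 -nd.
by apply/mem_orthovP => w _; exact: u0.
Qed.

Variable U : {vspace V}.
Local Notation "'U^|'" := (orthov form U).

Definition form_coords (x : V) : 'rV[R]_(\dim U) :=
  \row_i form x (vbasis U)`_i.

Lemma form_coords_linear : linear form_coords.
Proof. by move=> a x y; apply/rowP => i; rewrite !mxE linearPl. Qed.

HB.instance Definition _ :=
  GRing.isLinear.Build _ _ _ _ form_coords form_coords_linear.

(** The complement of [U] is the kernel of [form_coords], whose image has
    dimension at most [\dim U]. *)
Lemma dim_orthov_ge : (\dim {:V} <= \dim U^| + \dim U)%N.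
Proof.
rewrite -(limg_ker_dim (linfun form_coords)) capfv leq_add//; last first.
  by rewrite (leq_trans (dimvS (subvf _)))// dimvf /dim/= mul1n.
apply/dimvS/subvP => x; rewrite memv_ker lfunE/= => /eqP Tx0.
apply/mem_orthovP => w /coord_vbasis ->; rewrite linear_sumr big1// => i _.
by have /rowP/(_ i) := Tx0; rewrite linearZr/= !mxE => ->; rewrite mulr0.
Qed.

Hypothesis U_nondeg : nondegenerate_on form U.

Lemma orthov_add_full : (U^| + U = {:V})%VS.
Proof.
apply/eqP; rewrite eqEdim subvf dimv_disjoint_sum ?dim_orthov_ge//.
by rewrite capvC.
Qed.

(** A vector of the complement is orthogonal to [U] anyway, so being orthogonal
    to the complement too puts it in the radical. *)
Lemma orthov_nondegenerate u : nondegenerate form -> u \in U^| ->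
  (forall w, w \in U^| -> form u w = 0) -> u = 0.
Proof.
move=> nd uU u0; apply: nondegenerate_eq0 => // w.
have : w \in (U^| + U)%VS by rewrite orthov_add_full memvf.
move=> /memv_addP[w1 w1U [w2 w2U ->]].
by rewrite linearDr/= u0// (mem_orthovP uU)// addr0.
Qed.

End OrthogonalDecomposition.

(** * The j-mapping of a pseudo-H-type algebra *)

Section JMapping.
Context (R : realType) (V : vectType R) (g : lieAlgebra V).
Variable form : {symmetric V}.
Local Notation "'z" := (lie_center g).
Local Notation "'v" := (orthov form (lie_center g)).
Hypothesis g_step2 : step_two_nilpotent g.
Hypothesis form_nondeg : nondegenerate form.
Hypothesis z_nondeg : nondegenerate_on form 'z.
Variable j : subvs_of 'z -> 'End(subvs_of 'v).
Hypothesis jP : is_jmap j.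
Hypothesis jH : pseudo_H_type j.

Lemma bracketC x y : g x y = - g y x.
Proof.
apply/eqP; rewrite -addr_eq0; have := lie_bracketxx g (x + y).
by rewrite linearDl/= !linearDr/= !lie_bracketxx add0r addr0 => ->.
Qed.

Lemma jmap_skew Z (u w : subvs_of 'v) :
  form (vsval (j Z u)) (vsval w) = - form (vsval u) (vsval (j Z w)).
Proof. by rewrite jP (formC form (vsval u)) jP bracketC linearNr. Qed.

(** Both sides lie in the complement of the centre and pair equally with every
    vector there: move one factor across by skewness, then use the
    pseudo-H-type identity. *)
Lemma jmap_sqr Z u : j Z (j Z u) = - form (vsval Z) (vsval Z) *: u.
Proof.
apply/val_inj/eqP; rewrite -[val]/(vsval) linearZ/= -subr_eq0; apply/eqP.
apply: (orthov_nondegenerate z_nondeg form_nondeg).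
  by rewrite rpredB ?rpredZ ?subvsP.
move=> w wv; rewrite -(vsprojK wv) linearBl/= linearZl/= jmap_skew jH.
by rewrite mulNr subrr.
Qed.

(** The projections are kept as endomaps of the whole space, so that they can be
    composed, differentiated and compared without subspace types. *)
Definition vproj (y : V) : V := vsval (vpart g form y).
Definition zproj (y : V) : V := vsval (zpart g form y).

Let vz0 : ('v :&: 'z = 0)%VS. Proof. by rewrite capvC. Qed.

Lemma vprojE y : vproj y = daddv_pi 'v 'z y.
Proof. by rewrite /vproj /vpart vsprojK// memv_pi. Qed.

Lemma zprojE y : zproj y = daddv_pi 'z 'v y.
Proof. by rewrite /zproj /zpart vsprojK// memv_pi. Qed.

Lemma vproj_linear : linear vproj.
Proof. by move=> a x y; rewrite !vprojE linearP. Qed.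
HB.instance Definition _ := GRing.isLinear.Build _ _ _ _ vproj vproj_linear.

Lemma zproj_linear : linear zproj.
Proof. by move=> a x y; rewrite !zprojE linearP. Qed.
HB.instance Definition _ := GRing.isLinear.Build _ _ _ _ zproj zproj_linear.

Lemma vproj_in y : vproj y \in 'v. Proof. exact: subvsP. Qed.
Lemma zproj_in y : zproj y \in 'z. Proof. exact: subvsP. Qed.

Lemma vzproj_sum y : vproj y + zproj y = y.
Proof.
by rewrite vprojE zprojE daddv_pi_add// (orthov_add_full z_nondeg) memvf.
Qed.

Lemma vproj_id y : y \in 'v -> vproj y = y.
Proof. by move=> yv; rewrite vprojE daddv_pi_id. Qed.

Lemma zproj_id y : y \in 'z -> zproj y = y.
Proof. by move=> yz; rewrite zprojE daddv_pi_id. Qed.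

Lemma vproj_center y : y \in 'z -> vproj y = 0.
Proof.
move=> yz; have := vzproj_sum y.
by rewrite (zproj_id yz) -[RHS]add0r => /addIr.
Qed.

Lemma zproj_orthov y : y \in 'v -> zproj y = 0.
Proof.
move=> yv; have := vzproj_sum y.
by rewrite (vproj_id yv) -[RHS]addr0 => /addrI.
Qed.

Lemma form_vz x y : x \in 'v -> y \in 'z -> form x y = 0.
Proof. by move=> /mem_orthovP; apply. Qed.

(** On the diagonal this is the Lie-Poisson vector field; with the first argument
    fixed it is the linear vector field that governs the v-part of a
    solution. *)
Definition jfield (a b : V) : V := vsval (j (zpart g form a) (vpart g form b)).

Lemma jfield_in a b : jfield a b \in 'v. Proof. exact: subvsP. Qed.

Lemma jfield_linear a : linear (jfield a).
Proof. by move=> k x y; rewrite /jfield /vpart !linearP. Qed.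
HB.instance Definition _ a :=
  GRing.isLinear.Build _ _ _ _ (jfield a) (jfield_linear a).

Lemma eq_jfieldl a a' b : zproj a = zproj a' -> jfield a b = jfield a' b.
Proof. by rewrite /jfield => /val_inj ->. Qed.

Lemma jfield_vproj a b : jfield a (vproj b) = jfield a b.
Proof.
congr (vsval (j _ _)); apply/val_inj => /=.
by rewrite -/(vproj _) vproj_id ?vproj_in.
Qed.

Lemma bracket_vproj x y : g (vproj x) (vproj y) = g x y.
Proof.
have h b : b \in 'z -> forall a, g a b = 0.
  by move=> /lie_centerP h a; rewrite bracketC h oppr0.
rewrite -[in RHS](vzproj_sum x) -[in RHS](vzproj_sum y) linearDl/= !linearDr/=.
by rewrite !(h (zproj y)) ?zproj_in// (lie_centerP g _ (zproj_in x)) !addr0.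
Qed.

(** Identifies [jfield a b] as the transpose of the adjoint endomorphism [g b]
    applied to [a], with no projection left; the linearity in [a] and the link
    with the coadjoint action come from this formula. *)
Lemma form_jfield a b w : form (jfield a b) w = form a (g b w).
Proof.
rewrite -[in LHS](vzproj_sum w) linearDr/=.
rewrite [X in _ + X]form_vz ?jfield_in ?zproj_in//.
rewrite addr0 jP -/(zproj a) -/(vproj b) -/(vproj w) bracket_vproj.
rewrite -[in RHS](vzproj_sum a) linearDl/=.
by rewrite [X in _ = X + _]form_vz ?add0r ?vproj_in//; exact: g_step2.1.
Qed.

Lemma jfield_linearl b : linear (jfield ^~ b).
Proof.
move=> k x y; apply/eqP; rewrite -subr_eq0; apply/eqP.
apply: (nondegenerate_eq0 form_nondeg) => w.
by rewrite linearBl/= linearPl/= !form_jfield linearPl/= subrr.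
Qed.

Lemma jfield_sqr a b :
  jfield a (jfield a b) = - form (zproj a) (zproj a) *: vproj b.
Proof.
rewrite {1}/jfield.
have -> : vpart g form (jfield a b) = j (zpart g form a) (vpart g form b).
  by apply/val_inj; rewrite -[LHS]/(vproj _) vproj_id ?jfield_in.
by rewrite jmap_sqr linearZ.
Qed.

(** Otherwise polarization would make the form vanish on the complement of the
    centre, which would then be zero by nondegeneracy, and the algebra would be
    abelian. *)
Lemma exists_form_vproj_neq0 : exists x, form (vproj x) (vproj x) != 0.
Proof.
apply/not_existsP => h.
have {}h x : form (vproj x) (vproj x) = 0 by apply/eqP/negPn/negP/h.
have pol x y : form (vproj x) (vproj y) = 0.
  have := h (x + y); rewrite linearD/= linearDl/= !linearDr/= !h.
  rewrite add0r addr0 (formC form (vproj y)) => /eqP.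
  by rewrite -mulr2n mulrn_eq0/= => /eqP.
have [x [y]] := g_step2.2; rewrite -bracket_vproj.
have -> : vproj x = 0.
  apply: (orthov_nondegenerate z_nondeg form_nondeg); first exact: vproj_in.
  by move=> w wv; rewrite -(vproj_id wv).
by rewrite linear0l eqxx.
Qed.

Lemma form_vproj_jfield a b :
  form (vproj (jfield a b)) (vproj (jfield a b)) =
  form (zproj a) (zproj a) * form (vproj b) (vproj b).
Proof. by rewrite vproj_id ?jfield_in// jH. Qed.

(** This is <j(Z) v, v> = <Z, [v, v]> = 0. *)
Lemma form_jfield_vproj a b : form (jfield a b) (vproj b) = 0.
Proof. by rewrite -jfield_vproj form_jfield lie_bracketxx linear0r. Qed.

Lemma complex_eigenvalue_sqr Z (lambda : R[i]) :
  complex_eigenvalue (j Z) lambda ->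
  lambda ^+ 2 = (- form (vsval Z) (vsval Z))%:C%C.
Proof.
move=> /eigenvalueP [u uE u0]; set M := passmx.mxof _ _ _ in uE.
have MM : M *m M = (- form (vsval Z) (vsval Z))%:M.
  rewrite -passmx.mxof_comp; last exact: vbasisP.
  have -> : (j Z \o j Z)%VF = - form (vsval Z) (vsval Z) *: \1%VF.
    by apply/lfunP => w; rewrite comp_lfunE scale_lfunE id_lfunE jmap_sqr.
  rewrite -[_ *: \1%VF]addr0 passmx.mxof_linear.
  have /eqP -> :
      passmx.mxof (vbasis {:subvs_of 'v}) (vbasis {:subvs_of 'v}) 0 == 0.
    by rewrite passmx.mxof_eq0// vbasisP.
  by rewrite addr0 passmx.mxof1 ?scalemx1// (basis_free (vbasisP _)).
have : u *m map_mx (real_complex R) (M *m M) = lambda ^+ 2 *: u.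
  by rewrite map_mxM mulmxA uE -scalemxAl uE scalerA.
rewrite MM map_scalar_mx mul_mx_scalar => /eqP.
rewrite -subr_eq0 -scalerBl scaler_eq0 (negPf u0) orbF subr_eq0.
by move=> /eqP <-.
Qed.

End JMapping.

(** * Complex numbers with real square *)

Lemma Im_eq0_of_sqr_gt0 (R : realType) (c : R) (lambda : R[i]) :
  0 < c -> lambda ^+ 2 = c%:C%C -> complex.Im lambda = 0.
Proof.
case: lambda => a b c0; rewrite expr2 /GRing.mul/= => -[e1 e2].
have : a * b = 0 by lra.
move=> /eqP; rewrite mulf_eq0 => /orP[/eqP a0|/eqP//].
nra.
Qed.

Lemma Re_eq0_of_sqr_lt0 (R : realType) (c : R) (lambda : R[i]) :
  c < 0 -> lambda ^+ 2 = c%:C%C -> complex.Re lambda = 0.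
Proof.
case: lambda => a b c0; rewrite expr2 /GRing.mul/= => -[e1 e2].
have : a * b = 0 by lra.
move=> /eqP; rewrite mulf_eq0 => /orP[/eqP//|/eqP b0].
nra.
Qed.

(** * Continuity and derivatives *)

Section LinearMapsOnRowVectors.
Context (R : realType) (n : nat) (W : normedModType R).

Lemma linear_rV_continuous (f : 'rV[R]_n -> W) : linear f -> continuous f.
Proof.
move=> fL; pose F := GRing.isLinear.Build _ _ _ _ f fL.
pose ff : {linear 'rV[R]_n -> W} := HB.pack f F.
have -> : f = fun x => \sum_(i < n) x 0 i *: f 'e_i.
  apply/funext => x.
  rewrite -[LHS]/(ff x) [in LHS](row_sum_delta x) linear_sum/=.
  by apply: eq_bigr => i _; exact: (linearZ_LR ff).
apply: (@continuous_big _ _ _ _ _ (@add_continuous _)) => i _ x.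
have xi := @coord_continuous R 1 n 0 i x.
exact: (@cvgZr_tmp _ _ _ (nbhs x) _ _ _ _ xi).
Qed.

Lemma bilinear_diag_continuous (B : 'rV[R]_n -> 'rV[R]_n -> W) :
  (forall b, linear (B ^~ b)) -> (forall a, linear (B a)) ->
  continuous (fun x => B x x).
Proof.
move=> Bl Br.
have -> : (fun x => B x x) = fun x => \sum_(i < n) x 0 i *: B 'e_i x.
  apply/funext => x; pose F := GRing.isLinear.Build _ _ _ _ (B ^~ x) (Bl x).
  pose ff : {linear 'rV[R]_n -> W} := HB.pack (B ^~ x) F.
  rewrite -[LHS]/(ff x) [in LHS](row_sum_delta x) linear_sum/=.
  by apply: eq_bigr => i _; exact: (linearZ_LR ff).
apply: (@continuous_big _ _ _ _ _ (@add_continuous _)) => i _ x.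
have xi := @coord_continuous R 1 n 0 i x.
have Bi : B 'e_i y @[y --> x] --> B 'e_i x by exact: linear_rV_continuous.
exact: (@cvgZ _ _ _ (nbhs x) _ _ _ _ _ xi Bi).
Qed.

End LinearMapsOnRowVectors.

(** Only the germ of [f] at [x] matters; the point of the lemma is that the
    differential is characterised by the first-order expansion, so it can be
    read off without exhibiting differentiability beforehand. *)
Lemma differential_near_id (R : realType) (V : normedModType R) (f : V -> V)
    x v :
  (\near x, f x = x) -> 'd f x v = v.
Proof.
move=> fid; suff -> : 'd f x = idfun :> (V -> V) by [].
apply: (@diff_unique _ _ _ f idfun) => [y|]; first exact: cvg_id.
apply/eqaddoP => _/posnumP[e].
have fx := nbhs_singleton fid; move/nbhs0P : fid => fid.
near=> h.
have fh : f (x + h) = x + h by near: h.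
have -> : (f \o shift x - (cst (f x) + idfun)) h = 0.
  by rewrite !fctE/= (addrC h) fh fx subrr.
by rewrite normr0 mulr_ge0.
Unshelve. all: by end_near. Qed.

Lemma is_derive_linear_comp (R : realType) (U V W : normedModType R)
    (l : V -> W) (f : U -> V) x v df :
  linear l -> continuous l ->
  is_derive x v f df -> is_derive x v (fun y => l (f y)) (l df).
Proof.
move=> lL lC [fx <-]; pose F := GRing.isLinear.Build _ _ _ _ l lL.
pose ll : {linear V -> W} := HB.pack l F.
have lcvg : h^-1 *: (l (f (h *: v + x)) - l (f x)) @[h --> 0^'] -->
    l ('D_v f x).
  have -> : (fun h => h^-1 *: (l (f (h *: v + x)) - l (f x))) =
      l \o (fun h => h^-1 *: (f (h *: v + x) - f x)).
    by apply/funext => h; rewrite -[RHS]/(ll _) linearZ_LR (raddfB ll).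
  have fx' : h^-1 *: (f (h *: v + x) - f x) @[h --> 0^'] --> 'D_v f x by [].
  have lc : l y @[y --> 'D_v f x] --> l ('D_v f x) by exact: lC.
  exact: (@cvg_comp _ _ _ _ _ _ _ _ fx' lc).
by apply: DeriveDef; [apply/cvg_ex; exists (l ('D_v f x))|exact: cvg_lim].
Qed.

Lemma is_derive_coord (R : realType) (n : nat) (U : normedModType R)
    (f : U -> 'rV[R]_n) x v df i :
  is_derive x v f df -> is_derive x v (fun y => f y 0 i) (df 0 i).
Proof.
have L : linear (fun y : 'rV[R]_n => y 0 i : R^o).
  by move=> a b c; rewrite !mxE.
exact: (is_derive_linear_comp L (linear_rV_continuous L)).
Qed.

Lemma is_derive_row (R : realType) (n : nat) (U : normedModType R)
    (f : 'I_n -> U -> R) x v (df : 'I_n -> R) :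
  (forall i, is_derive x v (f i) (df i)) ->
  is_derive x v (fun y => \row_i f i y) (\row_i df i).
Proof.
move=> fD; have fx : derivable (fun y => \row_i f i y) x v.
  apply/derivable_mxP => k i.
  rewrite (_ : (fun y => _) = f i); first by have [] := fD i.
  by apply/funext => y; rewrite mxE.
apply: DeriveDef => //; rewrite derive_mx//; apply/matrixP => k i; rewrite !mxE.
rewrite (_ : (fun y => _) = f i); first by have [] := fD i.
by apply/funext => y; rewrite mxE.
Qed.

Lemma is_derive_expRM (R : realType) (k t : R) :
  is_derive t 1 (fun s => expR (k * s)) (k * expR (k * t)).
Proof.
have kD : is_derive t 1 (fun s : R => k * s) k.
  by apply: is_derive_eq; rewrite [LHS]mulr1.
have := is_derive1_comp (is_derive_expR (k * t)) kD.
by rewrite mulrC.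
Qed.

Lemma is_derive_expR_scale (R : realType) (V : normedModType R) (k t : R)
    (p : V) :
  is_derive t 1 (fun s => expR (k * s) *: p) ((k * expR (k * t)) *: p).
Proof.
have L : linear (fun a : R^o => a *: p).
  by move=> a b c; rewrite scalerDl scalerA.
apply: (is_derive_linear_comp L) (is_derive_expRM k t).
exact: scalel_continuous.
Qed.

Section NormRow.
Context (R : realType) (n : nat).

Lemma coord_le_norm (v : 'rV[R]_n) i : `|v 0 i| <= `|v|.
Proof.
rewrite [leRHS]/Num.norm/= mx_normrE.
exact: (le_bigmax _ _ (0, i)).
Qed.

Lemma norm_le_coord (v : 'rV[R]_n) e :
  0 <= e -> (forall i, `|v 0 i| <= e) -> `|v| <= e.
Proof.
move=> e0 h; rewrite [leLHS]/Num.norm/= mx_normrE.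
by apply: bigmax_le => // -[k i] _ /=; rewrite (ord1 k).
Qed.

End NormRow.

(** * The Lie-Poisson flow *)

Section Flow.
Context (R : realType) (n : nat).
Local Notation V := 'rV[R]_n.
Variables (g : lieAlgebra V) (form : {symmetric V}).
Local Notation "'z" := (lie_center g).
Local Notation "'v" := (orthov form (lie_center g)).
Hypothesis g_step2 : step_two_nilpotent g.
Hypothesis form_nondeg : nondegenerate form.
Hypothesis z_nondeg : nondegenerate_on form 'z.
Variable j : subvs_of 'z -> 'End(subvs_of 'v).
Hypothesis jP : is_jmap j.
Hypothesis jH : pseudo_H_type j.
Local Notation vproj := (vproj g form).
Local Notation zproj := (zproj g form).
Local Notation jfield := (jfield j).

(** The square <Y_z,Y_z>: a constant of motion whose sign decides between
    oscillation and exponential growth. *)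
Definition zcasimir (y : V) : R := form (zproj y) (zproj y).

Lemma vproj_continuous : continuous vproj.
Proof. by apply: linear_rV_continuous; exact: vproj_linear. Qed.

Lemma zproj_continuous : continuous zproj.
Proof. by apply: linear_rV_continuous; exact: zproj_linear. Qed.

Lemma jfield_diag_continuous : continuous (fun y => jfield y y).
Proof.
apply: bilinear_diag_continuous => [b|a]; last exact: jfield_linear.
exact: (jfield_linearl g_step2 form_nondeg z_nondeg jP).
Qed.

Lemma form_diag_continuous (f : V -> V) :
  linear f -> continuous (fun y => form (f y) (f y) : R^o).
Proof.
move=> fL; pose B a b := form (f a) (f b).
apply: (@bilinear_diag_continuous _ _ R^o B); rewrite /B.
  by move=> b k x y; rewrite fL linearPl.
by move=> a k x y; rewrite fL linearPr.
Qed.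

Lemma zcasimir_continuous : continuous (zcasimir : V -> R^o).
Proof. by apply: form_diag_continuous; exact: zproj_linear. Qed.

Lemma solution_zproj y t :
  lie_poisson_solution j y -> zproj (y t) = zproj (y 0).
Proof.
move=> ysol; apply/rowP => i.
apply: (@is_derive_0_is_cst _ (fun s => zproj (y s) 0 i)) => s.
by have := is_derive_coord i (ysol s).2; rewrite mxE.
Qed.

(** Along a solution, a coordinate [a] of the v-part and the same coordinate [b]
    of its image under the operator of the constant z-part satisfy a' = b and
    b' = - c a, where c is [zcasimir (y 0)]. *)
Lemma solution_energy y i t : lie_poisson_solution j y ->
  let E s :=
    zcasimir (y 0) * vproj (y s) 0 i ^+ 2 + jfield (y 0) (y s) 0 i ^+ 2 in
  E t = E 0.
Proof.
move=> ysol E; apply: (@is_derive_0_is_cst _ E) => s.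
have aD := is_derive_coord i (ysol s).1.
have jL : linear (jfield (y 0)) by exact: jfield_linear.
have := is_derive_linear_comp jL (linear_rV_continuous jL) (ysol s).1.
rewrite -/(jfield (y s) (y s)) (eq_jfieldl j _ (solution_zproj s ysol)).
rewrite (jfield_sqr form_nondeg z_nondeg jP jH) => /(is_derive_coord i).
under eq_fun do rewrite -[vsval _]/(vproj _) (jfield_vproj z_nondeg).
move=> bD.
rewrite (_ : E = zcasimir (y 0) *: (fun s => vproj (y s) 0 i) ^+ 2 +
   (fun s => jfield (y 0) (y s) 0 i) ^+ 2).
  apply: is_derive_eq.
  rewrite -/(jfield (y s) (y s)) (eq_jfieldl j _ (solution_zproj s ysol)) !mxE.
  rewrite /zcasimir /GRing.scale/=; ring.
by apply/funext.
Qed.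

Lemma solution_vproj_bound y e : lie_poisson_solution j y -> 0 <= e ->
  0 < zcasimir (y 0) ->
  zcasimir (y 0) * `|vproj (y 0)| ^+ 2 + `|jfield (y 0) (y 0)| ^+ 2 <=
    zcasimir (y 0) * e ^+ 2 ->
  forall t, `|vproj (y t)| <= e.
Proof.
move=> ysol e0 c0 he t; apply: norm_le_coord => // i.
rewrite -(@ler_pXn2r _ 2)// real_normK ?num_real// -(ler_pM2l c0).
apply: le_trans he; have := solution_energy i t ysol => /=.
move=> /(congr1 (fun x => x - jfield (y 0) (y t) 0 i ^+ 2)).
rewrite addrK => ->; rewrite lerBlDr ler_wpDr ?sqr_ge0//.
rewrite lerD ?ler_pM2l// -[leLHS]real_normK ?num_real//.
  by rewrite ler_pXn2r ?nnegrE// coord_le_norm.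
by rewrite ler_pXn2r ?nnegrE// coord_le_norm.
Qed.

(** Stability with respect to all of the Lie algebra, hence on any subset [O]:
    the constants in [solution_vproj_bound] depend continuously on the starting
    point. *)
Lemma center_lyapunov_stable (O : set V) Z : Z \in 'z -> 0 < form Z Z ->
  lyapunov_stable_on (lie_poisson_solution j) O Z.
Proof.
move=> Zz Z0 e e0.
have vZ : vproj Z = 0 by exact: vproj_center.
have zZ : zproj Z = Z by exact: zproj_id.
have JZ : jfield Z Z = 0.
  by rewrite -(jfield_vproj z_nondeg) vZ linear0.
(* [K y > 0] is the hypothesis of [solution_vproj_bound] for the bound
   [e / 2], written so that it is continuous in [y] and positive at [Z]. *)
pose K y := zcasimir y * (e / 2) ^+ 2 -
  (zcasimir y * `|vproj y| ^+ 2 + `|jfield y y| ^+ 2).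
have cC : zcasimir y @[y --> Z] --> (zcasimir Z : R^o).
  exact: zcasimir_continuous.
have KC : K y @[y --> Z] --> (K Z : R^o).
  have vC : vproj y @[y --> Z] --> vproj Z by exact: vproj_continuous.
  have jC : jfield y y @[y --> Z] --> jfield Z Z.
    exact: jfield_diag_continuous.
  have nvC : `|vproj y| @[y --> Z] --> `|vproj Z|.
    exact: (@cvg_norm _ _ _ (nbhs Z) (nbhs_filter Z) _ _ vC).
  have njC : `|jfield y y| @[y --> Z] --> `|jfield Z Z|.
    exact: (@cvg_norm _ _ _ (nbhs Z) (nbhs_filter Z) _ _ jC).
  have H := cvgB (cvgM cC (cvg_cst ((e / 2) ^+ 2)))
    (cvgD (cvgM cC (cvgM nvC nvC)) (cvgM njC njC)).
  exact: H.
have near1 : \forall y \near Z, 0 < K y.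
  apply: (cvgr_gt (K Z) KC).
  rewrite /K vZ JZ !normr0 expr0n/= mulr0 addr0 subr0.
  by rewrite mulr_gt0 ?exprn_gt0 ?divr_gt0// /zcasimir zZ.
have near2 : \forall y \near Z, 0 < zcasimir y.
  by apply: (cvgr_gt (zcasimir Z) cC); rewrite /zcasimir zZ.
have near3 : \forall y \near Z, `|zproj y - Z| < e / 2.
  have : zproj y @[y --> Z] --> zproj Z by exact: zproj_continuous.
  rewrite zZ => /cvgrPdist_lt.
  move=> /(_ (e / 2)); rewrite divr_gt0// => /(_ isT).
  by apply: filterS => y; rewrite distrC.
have /nbhs_ballP[d d0 dP] : \forall y \near Z,
    [/\ 0 < K y, 0 < zcasimir y & `|zproj y - Z| < e / 2].
  by near=> y; split; near: y.
exists d => // y ysol _ ydist t _.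
have [Ky cy zy] :
    [/\ 0 < K (y 0), 0 < zcasimir (y 0) & `|zproj (y 0) - Z| < e / 2].
  by apply: dP; rewrite -ball_normE/= distrC.
rewrite -(vzproj_sum z_nondeg (y t)) -addrA (solution_zproj t ysol).
rewrite (le_lt_trans (ler_normD _ _))// (splitr e) ler_ltD//.
apply: (solution_vproj_bound ysol) => //; first by rewrite divr_ge0 ?ltW.
by rewrite -subr_ge0 ltW.
Unshelve. all: by end_near. Qed.

(** The z-part being constant, the v-part splits along the two eigenspaces of
    the operator of that z-part.  The growing component [p] is nonzero, because
    otherwise [v] would be an eigenvector for a nonzero eigenvalue of a skew
    operator, hence isotropic. *)
Lemma unbounded_solution y0 : zcasimir y0 < 0 ->
  form (vproj y0) (vproj y0) != 0 ->
  exists y, [/\ lie_poisson_solution j y, y 0 = y0 &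
    forall e M, exists2 t, 0 <= t & M <= `|y t - e|].
Proof.
move=> c0 v0; set v := vproj y0 in v0.
pose l := Num.sqrt (- zcasimir y0).
have l0 : 0 < l by rewrite sqrtr_gt0 oppr_gt0.
have l2 : l ^+ 2 = - zcasimir y0 by rewrite sqr_sqrtr// oppr_ge0 ltW.
have ln0 : l != 0 by rewrite gt_eqF.
pose p := 2^-1 *: (v + l^-1 *: jfield y0 v).
pose q := 2^-1 *: (v - l^-1 *: jfield y0 v).
have JJv : jfield y0 (jfield y0 v) = l ^+ 2 *: v.
  by rewrite (jfield_sqr form_nondeg z_nondeg jP jH) l2 vproj_id// vproj_in.
have Jp : jfield y0 p = l *: p.
  rewrite /p linearZ/= linearD/= linearZ/= JJv !scalerA scalerDr addrC.
  by apply/rowP => i; rewrite !mxE; field.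
have Jq : jfield y0 q = - l *: q.
  rewrite /q linearZ/= linearB/= linearZ/= JJv.
  by apply/rowP => i; rewrite !mxE; field.
have pq : p + q = v by apply/rowP => i; rewrite !mxE; field.
have vv : v \in 'v by exact: vproj_in.
have pv : p \in 'v by rewrite rpredZ// rpredD// rpredZ// jfield_in.
have qv : q \in 'v by rewrite rpredZ// rpredB// rpredZ// jfield_in.
have p0 : p != 0.
  apply: contra_neq v0 => p0.
  have : form p v = 0 by rewrite p0 linear0l.
  rewrite /p linearZl_LR/= linearDl/= linearZl_LR/=.
  rewrite /v -/(vproj y0) (jfield_vproj z_nondeg).
  rewrite (form_jfield_vproj g_step2 z_nondeg jP) mulr0 addr0 => /eqP.
  by rewrite mulf_eq0 invr_eq0 pnatr_eq0/= => /eqP.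
(* The linearity rewrites below would otherwise unfold [p] and [q] instead of
   using that they are eigenvectors. *)
clearbody p q; pose w t := expR (l * t) *: p + expR (- l * t) *: q.
pose y t := zproj y0 + w t.
have wv t : w t \in 'v by rewrite /w rpredD// rpredZ.
have vy t : vproj (y t) = w t.
  by rewrite linearD/= (vproj_center z_nondeg) ?zproj_in// add0r vproj_id.
have zy t : zproj (y t) = zproj y0.
  by rewrite linearD/= (zproj_orthov z_nondeg (wv t)) addr0 zproj_id ?zproj_in.
exists y; split.
- move=> t; split.
    rewrite -/(jfield (y t) (y t)) (eq_jfieldl j _ (zy t)).
    rewrite -(jfield_vproj z_nondeg) vy.
    rewrite (_ : (fun s => _) = w); last by apply/funext => s; rewrite -vy.
    rewrite /w linearD/= !linearZ/= Jp Jq !scalerA.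
    rewrite [_ * l]mulrC [_ * - l]mulrC.
    by apply: is_deriveD; exact: is_derive_expR_scale.
  rewrite (_ : (fun s => _) = cst (zproj y0)); first exact: is_derive_cst.
  by apply/funext => s; rewrite -[LHS]/(zproj (y s)).
- by rewrite /y /w !mulr0 expR0 !scale1r pq addrC (vzproj_sum z_nondeg).
move=> e M.
(* The other terms of [y t - e] contribute at most [`|zproj y0 - e| + `|q|], and
   [1 + l t <= expR (l t)] makes the growing term reach [M'] at the time [t]
   chosen below. *)
pose M' := `|M| + `|zproj y0 - e| + `|q|.
have M'0 : 0 <= M' by rewrite !addr_ge0.
have pn : 0 < `|p| by rewrite normr_gt0.
pose t := M' / (l * `|p|).
have t0 : 0 <= t by rewrite divr_ge0// mulr_ge0// ltW.
exists t => //.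
have -> : y t - e = expR (l * t) *: p + ((zproj y0 - e) + expR (- l * t) *: q).
  by apply/rowP => i; rewrite /y /w !mxE; ring.
have e1 : `|expR (- l * t) *: q| <= `|q|.
  rewrite normrZ ler_piMl// ger0_norm ?expR_ge0// -expR0.
  rewrite ler_expR mulNr oppr_le0.
  by rewrite mulr_ge0// ltW.
have e2 : M' <= `|expR (l * t) *: p|.
  rewrite normrZ ger0_norm ?expR_ge0//.
  apply: (@le_trans _ _ ((1 + l * t) * `|p|)); last first.
    by rewrite ler_pM2r// expR_ge1Dx.
  rewrite mulrDl mul1r mulrAC /t [X in _ + X]mulrC divfK ?lerDr//.
  by rewrite mulf_neq0// gt_eqF.
have e3 := ler_normD (zproj y0 - e) (expR (- l * t) *: q).
have e4 :=
  lerB_normD (expR (l * t) *: p) ((zproj y0 - e) + expR (- l * t) *: q).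
have e5 := ler_norm M.
rewrite /M' in e2; lra.
Qed.

End Flow.

(** * Curves in a coadjoint orbit *)

Section Adjoint.
Context (R : realType) (n : nat) (form : {symmetric 'rV[R]_n}).
Hypothesis form_nondeg : nondegenerate form.

(** The row representing, in the canonical basis, the linear form
    [w |-> form x (A w)].  For the identity this is the map to the dual, an
    isomorphism by nondegeneracy; its inverse yields adjoints by an explicit
    formula through which derivatives pass. *)
Definition form_row (A : 'End('rV[R]_n)) (x : 'rV[R]_n) : 'rV[R]_n :=
  \row_i form x (A 'e_i).

Lemma form_row_linear A : linear (form_row A).
Proof. by move=> k x y; apply/rowP => i; rewrite !mxE linearPl. Qed.
HB.instance Definition _ A :=
  GRing.isLinear.Build _ _ _ _ (form_row A) (form_row_linear A).

Lemma lker_form_row : lker (linfun (form_row \1)) == 0%VS.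
Proof.
apply/lker0P => x y; rewrite !lfunE/= => /rowP xy; apply/eqP.
rewrite -subr_eq0; apply/eqP; apply: (nondegenerate_eq0 form_nondeg) => w.
rewrite (row_sum_delta w) linear_sumr big1// => i _.
have := xy i; rewrite !mxE id_lfunE => e.
by rewrite linearZr/= linearBl/= e subrr mulr0.
Qed.

Definition adjoint (A : 'End('rV[R]_n)) : 'End('rV[R]_n) :=
  ((linfun (form_row \1))^-1 \o linfun (form_row A))%VF.

Lemma form_row_adjoint A x : form_row \1 (adjoint A x) = form_row A x.
Proof.
have := lker0_lfunVK lker_form_row (linfun (form_row A) x).
by rewrite /adjoint comp_lfunE [X in X = _ -> _]lfunE/= => ->; rewrite lfunE.
Qed.

Lemma adjointP A : is_adjoint form A (adjoint A).
Proof.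
move=> x y; rewrite (row_sum_delta y) linear_sumr.
rewrite [A _]linear_sum/= linear_sumr/=.
apply: eq_bigr => i _; rewrite [A _]linearZ/= !linearZr/=; congr (_ * _).
by have /rowP/(_ i) := form_row_adjoint A x; rewrite !mxE id_lfunE.
Qed.

(** Transposition is linear, so the derivative of (A u)^T Y is the vector
    representing [w |-> form Y (dA w)].  Pointwise differentiability of [A] is
    enough since only the images of basis vectors enter. *)
Lemma is_derive_adjoint (U : normedModType R) (A : U -> 'End('rV[R]_n))
    (dA : 'rV[R]_n -> 'rV[R]_n) Y dY (x v : U) :
  (forall w, is_derive x v (fun u => A u w) (dA w)) ->
  (forall w, form dY w = form Y (dA w)) ->
  is_derive x v (fun u => adjoint (A u) Y) dY.
Proof.
move=> AD dYE; pose S := (linfun (form_row \1))^-1%VF.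
have rowD : is_derive x v (fun u => form_row (A u) Y)
    (\row_i form Y (dA 'e_i)).
  apply: is_derive_row => i.
  have L : linear (fun w => form Y w : R^o) by move=> k a b; rewrite linearPr.
  exact: (is_derive_linear_comp L (linear_rV_continuous L) (AD 'e_i)).
have SL : linear S by move=> k a b; rewrite linearP.
have := is_derive_linear_comp SL (linear_rV_continuous SL) rowD.
rewrite (_ : S _ = dY).
  congr (is_derive _ _ _ _); apply/funext => u.
  by rewrite /adjoint comp_lfunE lfunE.
rewrite -[RHS](lker0_lfunK lker_form_row) /S; congr (_ _).
by rewrite lfunE; apply/rowP => i; rewrite !mxE id_lfunE dYE.
Qed.

End Adjoint.

(** Conjugation by the identity, read in the chart, is the identity near
    [c 1], because the chart image is open. *)
Lemma Ad1 (R : realType) (n : nat) (G : topologicalGroupType)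
    (c : chart R n G) w :
  chart_dom c 1%g -> Ad c 1%g w = w.
Proof.
move=> c1; have nimg : nbhs (c 1%g) (c @` chart_dom c).
  by apply: open_nbhs_nbhs; split; [exact: chart_img_open|exists 1%g].
have fid : \forall x \near c 1%g, c (1 * chart_inv c x * 1^-1)%g = x.
  by apply: filterS nimg => _ [p cp <-]; rewrite chart_mapK// mul1g invg1 mulg1.
rewrite /Ad lfunE/=; exact: differential_near_id.
Qed.

Lemma derive_line_cvg (R : realType) (V W : normedModType R) (f : V -> W)
    x v df :
  is_derive x v f df ->
  s^-1 *: (f (s *: v + x) - f x) @[s --> 0^'] --> df.
Proof. by move=> [fx <-]. Qed.

Lemma derive_line_continuous (R : realType) (V W : normedModType R) (f : V -> W)
    x v df :
  is_derive x v f df -> f (s *: v + x) @[s --> 0^'] --> f x.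
Proof.
move=> /derive_line_cvg fD.
have s0 : (s : R) @[s --> 0^'] --> (0 : R) by apply: cvg_within.
have H : s *: (s^-1 *: (f (s *: v + x) - f x)) + f x @[s --> 0^'] -->
    0 *: df + f x.
  by apply: cvgD; [exact: cvgZ s0 fD|exact: cvg_cst].
rewrite scale0r add0r in H; refine (cvg_trans (near_eq_cvg _) H).
near=> s; rewrite /= scalerA divff ?scale1r ?subrK//.
by near: s; exact: nbhs_dnbhs_neq.
Unshelve. all: by end_near. Qed.

(** * Instability on the orbit *)

Section Instability.
Context (R : realType) (n : nat) (G : topologicalGroupType).
Variables (c : chart R n G) (g : lieAlgebra 'rV[R]_n).
Variable form : {symmetric 'rV[R]_n}.
Hypothesis c_dom1 : chart_dom c 1%g.
Hypothesis gG : is_lie_algebra_of c g.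
Hypothesis g_step2 : step_two_nilpotent g.
Hypothesis form_nondeg : nondegenerate form.
Hypothesis z_nondeg : nondegenerate_on form (lie_center g).
Variable j :
  subvs_of (lie_center g) -> 'End(subvs_of (orthov form (lie_center g))).
Hypothesis jP : is_jmap j.
Hypothesis jH : pseudo_H_type j.

Lemma adjoint_id (A : 'End('rV[R]_n)) Y :
  (forall w, A w = w) -> adjoint form A Y = Y.
Proof.
move=> A1; apply/eqP; rewrite -subr_eq0; apply/eqP.
apply: (nondegenerate_eq0 form_nondeg) => w.
by rewrite linearBl/= (adjointP form_nondeg) A1 subrr.
Qed.

(** The derivative of [Ad] is the bracket, and by [form_jfield] transposing the
    bracket gives [jfield]. *)
Lemma orbit_curve_derive Z X :
  is_derive (c 1%g) X (fun x => adjoint form (Ad c (chart_inv c x)) Z)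
    (jfield j Z X).
Proof.
apply: (is_derive_adjoint form_nondeg) => [w|w]; first exact: gG.
exact: (form_jfield g_step2 z_nondeg jP).
Qed.

(** All points [y s] of an orbit curve with small nonzero [s] are close to [Z],
    have negative [zcasimir], and have a v-part of nonzero square; the last
    holds because this square divided by [s ^+ 2] tends to that of the velocity. *)
Lemma center_unstable Z : Z \in lie_center g -> form Z Z < 0 ->
  unstable_on (lie_poisson_solution j) (coadjoint_orbit c form Z) Z.
Proof.
move=> Zz Z0 /(_ 1 ltr01) [d d0 dP].
have zZ : zproj g form Z = Z by exact: zproj_id.
have [X X0] := exists_form_vproj_neq0 g_step2 form_nondeg z_nondeg.
pose f x := adjoint form (Ad c (chart_inv c x)) Z.
have fD : is_derive (c 1%g) X f (jfield j Z X) by exact: orbit_curve_derive.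
have f1 : f (c 1%g) = Z.
  by apply: adjoint_id => w; rewrite chart_mapK// Ad1.
pose y s := f (s *: X + c 1%g).
have yC : y s @[s --> 0^'] --> Z.
  by rewrite -f1; exact: derive_line_continuous fD.
have yD : s^-1 *: (y s - Z) @[s --> 0^'] --> jfield j Z X.
  by have := derive_line_cvg fD; rewrite f1.
have near1 : \forall s \near 0^', `|y s - Z| < d.
  by move/cvgrPdist_lt : yC => /(_ d d0); apply: filterS => s; rewrite distrC.
have near2 : \forall s \near 0^', zcasimir g form (y s) < 0.
  have cC : zcasimir g form a @[a --> Z] --> (zcasimir g form Z : R^o).
    exact: zcasimir_continuous.
  have H : zcasimir g form (y s) @[s --> 0^'] --> zcasimir g form Z.
    exact: cvg_comp yC cC.
  by apply: (cvgr_lt _ H); rewrite /zcasimir zZ.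
pose N a : R := form (vproj g form a) (vproj g form a).
have near3 : \forall s \near 0^', N (y s) != 0.
  have NC : N a @[a --> jfield j Z X] --> (N (jfield j Z X) : R^o).
    by apply: form_diag_continuous; exact: vproj_linear.
  have H : N (s^-1 *: (y s - Z)) @[s --> 0^'] --> N (jfield j Z X).
    exact: cvg_comp yD NC.
  have N0 : N (jfield j Z X) != 0.
    rewrite /N (form_vproj_jfield z_nondeg jH) zZ mulf_neq0//.
    by rewrite lt_eqF.
  have near_quot : \forall s \near 0^', N (s^-1 *: (y s - Z)) != 0.
    by apply: cvgr_neq0 H N0.
  apply: filterS near_quot => s.
  apply: contra_neq => Ns.
  rewrite /N linearZ/= linearB/= (vproj_center z_nondeg Zz) subr0.
  by rewrite linearZl_LR/= linearZr_LR/= -/(N (y s)) Ns !mulr0.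
have [s [sd sc sN]] : exists s, [/\ `|y s - Z| < d, zcasimir g form (y s) < 0 &
    N (y s) != 0].
  apply: (@filter_ex _ (0 : R)^').
  by apply: filterS3 near1 near2 near3 => s.
have [u [usol u0 uinf]] :=
  unbounded_solution g_step2 form_nondeg z_nondeg jP jH sc sN.
have [t t0] := uinf Z 1.
rewrite leNgt dP// u0//.
exists (chart_inv c (s *: X + c 1%g)).
exists (adjoint form (Ad c (chart_inv c (s *: X + c 1%g)))).
by split => //; exact: adjointP.
Qed.

End Instability.

Theorem theorem3p7 (R : realType) (n : nat) (G : topologicalGroupType)
    (L : lieGroup R n G) (c : chart R n G)
    (c_atlas : atlas L c) (c_dom1 : chart_dom c 1%g)
    (g : lieAlgebra 'rV[R]_n) (gG : is_lie_algebra_of c g)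
    (g_step2 : step_two_nilpotent g)
    (form : {symmetric 'rV[R]_n}) (form_nondeg : nondegenerate form)
    (form_center_nondeg : nondegenerate_on form (lie_center g))
    (j : subvs_of (lie_center g) -> 'End(subvs_of (orthov form (lie_center g))))
    (jP : is_jmap j) (G_pseudoH : pseudo_H_type j)
    (Z : subvs_of (lie_center g)) :
  (form (vsval Z) (vsval Z) < 0 ->
     (forall lambda, complex_eigenvalue (j Z) lambda -> complex.Im lambda = 0) /\
     unstable_on (lie_poisson_solution j) (coadjoint_orbit c form (vsval Z))
       (vsval Z)) /\
  (0 < form (vsval Z) (vsval Z) ->
     (forall lambda, complex_eigenvalue (j Z) lambda -> complex.Re lambda = 0) /\
     lyapunov_stable_on (lie_poisson_solution j)
       (coadjoint_orbit c form (vsval Z)) (vsval Z)).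
Proof.
split=> Z0; split.
- move=> lambda.
  move=> /(complex_eigenvalue_sqr form_nondeg form_center_nondeg jP G_pseudoH).
  by apply: Im_eq0_of_sqr_gt0; rewrite oppr_gt0.
- exact: (center_unstable c_dom1 gG g_step2 form_nondeg form_center_nondeg jP
    G_pseudoH (subvsP Z)).
- move=> lambda.
  move=> /(complex_eigenvalue_sqr form_nondeg form_center_nondeg jP G_pseudoH).
  by apply: Re_eq0_of_sqr_lt0; rewrite oppr_lt0.
- exact: (center_lyapunov_stable g_step2 form_nondeg form_center_nondeg jP
    G_pseudoH _ (subvsP Z)).
Qed.
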